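(* Let $n\in\mathbb{R}^+$, $f\in D_{HK}$ and $\phi\in BV[a,b]$. Then $$\int_a^b\phi(x)\,\mathcal{J}_a^nf(x)\,dx=\int_a^b f(t)\,\mathcal{J}_{b_-}^n\phi(t)\,dt.$$
   Context: Fix real numbers $a<b$; $BV[a,b]$ is the space of functions of bounded variation on $[a,b]$. Let $C_0=\{F\in C[a,b]:F(a)=0\}$. A distribution $f$ on $(a,b)$ is Henstock–Kurzweil integrable if $f=F'$ (distributional derivative) for some (unique) $F\in C_0$; $\int_c^d f=F(d)-F(c)$, and for $g\in BV[a,b]$, $\int_a^b fg=F(b)g(b)-\int_a^bF\,dg$. $D_{HK}$ is the space of these with the Alexiewicz norm $\|f\|_A=\sup_{[a,b]}|F|$; $L^1[a,b]$ is dense in it. Left Riemann–Liouville integral: for $n\ge1$, $\mathcal{J}_a^nf(x)=\frac{1}{\Gamma(n)}\int_a^x(x-t)^{n-1}f(t)\,dt$; for $0<n<1$, $\mathcal{J}_a^nf(x)=\frac{1}{\Gamma(n)}\lim_{k}\int_a^x(x-t)^{n-1}f_k(t)\,dt$ with $(f_k)\subset L^1[a,b]$, $\|f_k-f\|_A\to0$. Right-sided Riemann–Liouville integral: for $n\ge1$, $\mathcal{J}_{b_-}^n\phi(x)=\frac{1}{\Gamma(n)}\int_x^b(t-x)^{n-1}\phi(t)\,dt$; for $0<n<1$ defined analogously by the limit over $L^1$ approximations (for $\phi\in BV[a,b]$ it is the classical Lebesgue integral). *)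

(* Defs.v *)
From HB Require Import structures.
From mathcomp Require Import all_boot all_order all_algebra.
From mathcomp Require Import all_classical all_reals all_analysis.
Set Implicit Arguments. Unset Strict Implicit. Unset Printing Implicit Defensive.
Import Order.TTheory GRing.Theory Num.Theory.
Import numFieldNormedType.Exports.
Local Open Scope classical_set_scope.
Local Open Scope ring_scope.

(* Henstock--Kurzweil integrable distributions f on (a,b) are represented by
   their (unique) primitive F in C_0 = {F in C[a,b] : F(a) = 0}, f = F'. *)

Section HK.
Context {R : realType}.
Local Notation mu := (@lebesgue_measure R).

Definition C0 (a b : R) (F : R -> R) :=
  {within `[a, b], continuous F} /\ F a = 0.

(** Riemann--Stieltjes integral  int_a^b F dg  (limit of tagged sums as the
    mesh tends to 0). A partition of [a,b] is  a :: s  with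
    itv_partition a b s (strictly increasing, ending at b); the tag of the
    i-th subinterval is t i. *)
Definition RS_sum (F g : R -> R) (a : R) (s : seq R) (t : nat -> R) : R :=
  \sum_(i < size s)
     F (t i) * (g (nth 0 (a :: s) i.+1) - g (nth 0 (a :: s) i)).

Definition tags_ok (a : R) (s : seq R) (t : nat -> R) :=
  forall i, (i < size s)%N -> nth 0 (a :: s) i <= t i <= nth 0 (a :: s) i.+1.

Definition mesh (a : R) (s : seq R) : R :=
  \big[Num.max/0]_(i < size s) (nth 0 (a :: s) i.+1 - nth 0 (a :: s) i).

Definition is_RS (F g : R -> R) (a b I : R) :=
  forall e : R, 0 < e -> exists2 d : R, 0 < d &
    forall s t, itv_partition a b s -> tags_ok a s t -> mesh a s < d ->
      `|RS_sum F g a s t - I| < e.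

(** HK integral of the product f g over [a,x] (f with primitive F, F(a)=0,
    g of bounded variation):  int_a^x f g = F(x) g(x) - int_a^x F dg. *)
Definition is_HKprod (F g : R -> R) (a x v : R) :=
  exists2 J, is_RS F g a x J & v = F x * g x - J.

Definition Gamma (n : R) : R :=
  \int[mu]_(t in `]0, +oo[) (t `^ (n - 1) * expR (- t)).

Definition RLJ_ge1 (a n : R) (F : R -> R) (x y : R) :=
  exists2 v, is_HKprod F (fun t => (x - t) `^ (n - 1)) a x v &
             y = v / Gamma n.

Definition RLJ_L1 (a n : R) (f : R -> R) (x : R) : R :=
  (Gamma n)^-1 * \int[mu]_(t in `[a, x]) ((x - t) `^ (n - 1) * f t).

Definition prim (a : R) (h : R -> R) (x : R) : R := \int[mu]_(t in `[a, x]) h t.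

(** convergence in the Alexiewicz norm, expressed on primitives:
    sup_{[a,b]} |Fk - F| -> 0 *)
Definition alex_cvg (a b : R) (Fk : nat -> R -> R) (F : R -> R) :=
  forall e : R, 0 < e -> \forall k \near \oo,
    forall x, a <= x <= b -> `|Fk k x - F x| < e.

(** For 0 < n < 1: H is the primitive of J_a^n f in D_HK, i.e. J_a^n f is the
    D_HK-limit of J_a^n f_k for any (f_k) in L^1 with ||f_k - f||_A -> 0. *)
Definition RLJ_frac_prim (a b n : R) (F H : R -> R) :=
  C0 a b H /\
  forall fk : nat -> R -> R,
    (forall k, mu.-integrable `[a, b] (EFin \o fk k)) ->
    alex_cvg a b (fun k => prim a (fk k)) F ->
    alex_cvg a b (fun k => prim a (RLJ_L1 a n (fk k))) H.

Definition LHS_val (a b n : R) (F phi : R -> R) (v : R) :=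
  if 1 <= n then
    exists h : R -> R,
      [/\ forall x, a <= x <= b -> RLJ_ge1 a n F x (h x),
          mu.-integrable `[a, b] (EFin \o (fun x => phi x * h x)) &
          v = \int[mu]_(x in `[a, b]) (phi x * h x)]
  else
    exists2 H, RLJ_frac_prim a b n F H & is_HKprod H phi a b v.

Definition RLJ_right (b n : R) (phi : R -> R) (x : R) : R :=
  (Gamma n)^-1 * \int[mu]_(t in `[x, b]) ((t - x) `^ (n - 1) * phi t).

End HK.

(* Main.v *)
(* Idea. Let k(u) = u^(n-1) on u > 0, and let F and phi be extended to the real line.
   Both sides are integrals, over a parameter, of Riemann--Stieltjes integrals:
   - for n >= 1, G = J_{b-}^n phi is a superposition of the monotone functions
     k(s - .) with weights phi(s) ds / Gamma(n), and the Stieltjes integral of F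
     against k(s - .) is, up to sign and the jump at s, Gamma(n) J_a^n f(s);
   - for n < 1, G is a superposition of the translates phi(. + u) and the primitive H
     of J_a^n f one of the translates F(. - u), both with weights k(u) du / Gamma(n),
     and a Stieltjes integral is translation invariant.
   The parameter integral and the Stieltjes integral may be exchanged since the
   Stieltjes sums converge uniformly in the parameter. *)
Require Import Defs.
From HB Require Import structures.
From mathcomp Require Import all_boot all_order all_algebra.
From mathcomp Require Import all_classical all_reals all_analysis.
From mathcomp Require Import measurable_realfun ring lra.
Set Implicit Arguments. Unset Strict Implicit. Unset Printing Implicit Defensive.
Import Order.TTheory GRing.Theory Num.Theory.
Import numFieldNormedType.Exports.
Local Open Scope classical_set_scope.
Local Open Scope ring_scope.

(** * Stieltjes sums on the line and their limits *)

Section stieltjes_sums.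
Context {R : realType}.
Implicit Types (F g V : R -> R) (x y t : nat -> R) (a b d e : R) (N M : nat).

(** The split at [n = 1] is forced by the kernel. For [n < 1] it is unbounded near 0, so its
    translates are no Stieltjes integrators, and the fractional integral of [f] is accessible only
    through its primitive; for [n >= 1] the translates are monotone and its values at points are at
    hand. Since [f] is known only through [F], Fubini's theorem serves for the L1 approximations
    alone. The exchange for [F] itself needs Stieltjes integrals that are measurable in the
    parameter, with an error controlled by a modulus of continuity and a bound on the variation:
    hence [rs_int], the limit of one fixed sequence of sums, and [dominated], which records the
    variation by a majorant [V]. Boundary terms come from jumps. Extending [phi] by 0 beyond [b], or
    cutting the kernel off at 0, creates a jump whose Stieltjes contribution is the boundary term on
    the left side; on the right side that term is 0, as the right-sided integral vanishes at [b]. *)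

Definition stieltjes_sum F g x t N : R :=
  \sum_(i < N) F (t i) * (g (x i.+1) - g (x i)).

Definition tagged_partition a b d x t N :=
  [/\ x 0 = a, x N = b &
      forall i, (i < N)%N -> x i <= t i <= x i.+1 /\ x i.+1 - x i <= d].

(** Bounded variation in the form used throughout: [V], [V + g] and [V - g] are nondecreasing on the
    whole line. Translating [g] and [V] together preserves it. *)
Definition dominated g V := forall p q, p <= q -> `|g q - g p| <= V q - V p.

Definition unif_cont F :=
  forall e, 0 < e -> exists2 d, 0 < d &
    forall p q, `|p - q| <= d -> `|F p - F q| <= e.

Lemma tagged_partition_bounds a b d x t N : tagged_partition a b d x t N ->
  forall i, (i <= N)%N -> a <= x i <= b.
Proof.
move=> [x0 xN xt].
have le1 i : (i < N)%N -> x i <= x i.+1.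
  by move=> /xt[/andP[h1 h2] _]; exact: le_trans h2.
move=> i iN; apply/andP; split.
  elim: i iN => [|i IH] iN; first by rewrite x0.
  by rewrite (le_trans (IH (ltnW iN)))// le1.
have lek k : (i + k <= N)%N -> x i <= x (i + k)%N.
  elim: k => [|k IH]; first by rewrite addn0.
  rewrite addnS => ikN; exact: le_trans (IH (ltnW ikN)) (le1 _ ikN).
by rewrite -xN -(subnKC iN) lek// subnKC.
Qed.

(* The mass that dh gives to the intersection of [p, p'] and [q, q']: summing it over
   one of two partitions telescopes, so two partitions can be compared without
   forming a common refinement. *)
Definition mixed_diff (h : R -> R) p p' q q' :=
  h (Num.min p' q') - h (Num.min p' q) - (h (Num.min p q') - h (Num.min p q)).

Lemma mixed_diffC h p p' q q' : mixed_diff h p p' q q' = mixed_diff h q q' p p'.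
Proof. by rewrite /mixed_diff !(minC p) !(minC p'); ring. Qed.

Lemma sum_mixed_diff h a b p p' y M : y 0%N = a -> y M = b -> a <= p -> p <= p' -> p' <= b ->
  \sum_(j < M) mixed_diff h p p' (y j) (y j.+1) = h p' - h p.
Proof.
move=> y0 yM ap pp' p'b; rewrite sumrB.
have tel q : \sum_(j < M) (h (Num.min q (y j.+1)) - h (Num.min q (y j))) =
    h (Num.min q b) - h (Num.min q a).
  by rewrite -yM -y0 -(telescope_sumr (fun i => h (Num.min q (y i))))// big_mkord.
rewrite !tel (min_l p'b) (min_l (le_trans pp' p'b)) (min_r ap).
by rewrite (min_r (le_trans ap pp')); ring.
Qed.

(** If the cells do not overlap, the minima cancel and the mass is 0 for every [h]; otherwise it is
    the increment of [h] over the intersection, where domination applies. So [r] has to be small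
    only for overlapping cells. *)
Lemma mixed_diff_dominated g V e p p' q q' r : dominated g V -> p <= p' -> q <= q' ->
  (p < q' -> q < p' -> `|r| <= e) ->
  `|r * mixed_diff g p p' q q'| <= e * mixed_diff V p p' q q'.
Proof.
move=> gV pp' qq' re.
have [p'q|qp'] := leP p' q.
  have h0 h : mixed_diff h p p' q q' = 0.
    rewrite /mixed_diff (min_l (le_trans p'q qq')) (min_l p'q).
    by rewrite (min_l (le_trans pp' (le_trans p'q qq'))) (min_l (le_trans pp' p'q)) !subrr.
  by rewrite !h0 !mulr0 normr0.
have [q'p|pq'] := leP q' p.
  have h0 h : mixed_diff h p p' q q' = 0.
    rewrite /mixed_diff (min_r (le_trans q'p pp')) (min_r q'p).
    by rewrite (min_r (le_trans qq' (le_trans q'p pp'))) (min_r (le_trans qq' q'p)) subrr.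
  by rewrite !h0 !mulr0 normr0.
have hE h : mixed_diff h p p' q q' = h (Num.min p' q') - h (Num.max p q).
  rewrite /mixed_diff (min_l (ltW pq')) (min_r (ltW qp')).
  by have [pq|qp] := leP p q; ring.
rewrite normrM !hE ler_pM// ?re// gV// le_min !ge_max pp' qq'.
by rewrite !ltW.
Qed.

(** Both sums become double sums over pairs of cells, and their difference weighs
    [F (t i) - F (s j)] by the mass of the pair. Overlapping cells have tags at distance at most
    [d + d'], and the masses of [V] add up to [V b - V a]. *)
Lemma stieltjes_sum_close F g V a b d d' e x t N y s M :
  tagged_partition a b d x t N -> tagged_partition a b d' y s M ->
  dominated g V -> (forall p q, `|p - q| <= d + d' -> `|F p - F q| <= e) ->
  `|stieltjes_sum F g x t N - stieltjes_sum F g y s M| <= e * (V b - V a).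
Proof.
move=> Px Py gV osc.
have [x0 xN xt] := Px; have [y0 yM ys] := Py.
have xb := tagged_partition_bounds Px; have yb := tagged_partition_bounds Py.
have xle i : (i < N)%N -> x i <= x i.+1.
  by move=> /xt[/andP[h1 h2] _]; exact: le_trans h2.
have yle i : (i < M)%N -> y i <= y i.+1.
  by move=> /ys[/andP[h1 h2] _]; exact: le_trans h2.
have xsum h (i : 'I_N) : h (x i.+1) - h (x i) =
    \sum_(j < M) mixed_diff h (x i) (x i.+1) (y j) (y j.+1).
  have /andP[h1 _] := xb i (ltnW (ltn_ord i)); have /andP[_ h2] := xb i.+1 (ltn_ord i).
  by rewrite (sum_mixed_diff _ y0 yM)// xle.
have ysum h (j : 'I_M) : h (y j.+1) - h (y j) =
    \sum_(i < N) mixed_diff h (x i) (x i.+1) (y j) (y j.+1).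
  have /andP[h1 _] := yb j (ltnW (ltn_ord j)); have /andP[_ h2] := yb j.+1 (ltn_ord j).
  rewrite -(sum_mixed_diff h x0 xN h1 (yle _ (ltn_ord j)) h2).
  by apply: eq_bigr => i _; rewrite mixed_diffC.
have -> : V b - V a = \sum_(i < N) \sum_(j < M) mixed_diff V (x i) (x i.+1) (y j) (y j.+1).
  rewrite -xN -x0 -(telescope_sumr (fun i => V (x i)))// big_mkord.
  by apply: eq_bigr => i _; rewrite xsum.
have -> : stieltjes_sum F g x t N - stieltjes_sum F g y s M =
    \sum_(i < N) \sum_(j < M) (F (t i) - F (s j)) * mixed_diff g (x i) (x i.+1) (y j) (y j.+1).
  have -> : stieltjes_sum F g y s M = \sum_(i < N) \sum_(j < M)
     F (s j) * mixed_diff g (x i) (x i.+1) (y j) (y j.+1).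
    rewrite exchange_big /=; apply: eq_bigr => j _.
    by rewrite ysum mulr_sumr.
  rewrite -sumrB; apply: eq_bigr => i _; rewrite xsum mulr_sumr -sumrB.
  by apply: eq_bigr => j _; rewrite mulrBl.
rewrite mulr_sumr; apply: le_trans (ler_norm_sum _ _ _) _; apply: ler_sum => i _.
rewrite mulr_sumr; apply: le_trans (ler_norm_sum _ _ _) _; apply: ler_sum => j _.
apply: mixed_diff_dominated => //; [exact: xle|exact: yle|move=> h1 h2; apply: osc].
have [/andP[? ?] ?] := xt _ (ltn_ord i); have [/andP[? ?] ?] := ys _ (ltn_ord j).
by rewrite ler_norml; apply/andP; split; lra.
Qed.

Definition regular_partition a b N i : R := a + (b - a) * (i%:R / N.+1%:R).

(** Tags are left endpoints: the first tag is exactly [a], so the contribution of a jump at [a] is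
    exact already for the sums. *)
Definition regular_sum F g a b N : R :=
  stieltjes_sum F g (regular_partition a b N) (regular_partition a b N) N.+1.

Lemma regular_partitionP a b N : a <= b ->
  tagged_partition a b ((b - a) / N.+1%:R)
    (regular_partition a b N) (regular_partition a b N) N.+1.
Proof.
move=> ab; split; rewrite /regular_partition.
- by rewrite mul0r mulr0 addr0.
- by rewrite divff// mulr1 addrC subrK.
move=> i _.
have -> : a + (b - a) * (i.+1%:R / N.+1%:R) =
   a + (b - a) * (i%:R / N.+1%:R) + (b - a) / N.+1%:R.
  by rewrite -[i.+1%:R]natr1; ring.
have ? : 0 <= (b - a) / N.+1%:R by rewrite divr_ge0// subr_ge0.
by rewrite lexx lerDl addrAC subrr add0r.
Qed.

Lemma regular_mesh_small a b d : 0 < d ->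
  \forall N \near \oo, (b - a) / N.+1%:R <= d.
Proof.
move=> d0; exists (Num.trunc (`|b - a| / d)).+1 => // N /= hN.
have := truncnS_gt (`|b - a| / d); rewrite ltr_pdivrMr// => h.
rewrite ler_pdivrMr//; apply: le_trans (ler_norm _) _; apply: le_trans (ltW h) _.
by rewrite mulrC ler_pM2l// ler_nat (leq_trans hN).
Qed.

Definition rs_int F g a b : R := limn (regular_sum F g a b).

(** The shape of the error bounds below; the [+ 1] covers [W = 0]. *)
Lemma ltr_divD1M e W : 0 < e -> 0 <= W -> e / (W + 1) * W < e.
Proof.
move=> e0 W0; rewrite -mulrA gtr_pMr// mulrC ltr_pdivrMr ?ltr_wpDl//.
by rewrite mul1r ltrDl.
Qed.

Lemma cvg_regular_sum F g V a b : a <= b -> unif_cont F -> dominated g V ->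
  regular_sum F g a b N @[N --> \oo] --> rs_int F g a b.
Proof.
move=> ab ucF gV; apply: cauchy_cvg; apply/cauchy_exP => e e0.
have Vab : 0 <= V b - V a by apply: le_trans (normr_ge0 _) (gV _ _ ab).
have e'0 : 0 < e / (V b - V a + 1) by rewrite divr_gt0// ltr_wpDl.
have [d d0 osc] := ucF _ e'0.
have d20 : 0 < d / 2 by rewrite divr_gt0.
have [N0 _ hN0] := regular_mesh_small a b d20.
exists (regular_sum F g a b N0); exists N0 => // N /= hN.
rewrite /ball_ /=.
have H : `|regular_sum F g a b N0 - regular_sum F g a b N| <=
    e / (V b - V a + 1) * (V b - V a).
  apply: stieltjes_sum_close (regular_partitionP _ ab) (regular_partitionP _ ab) gV _.
  move=> p q pq; apply: osc; apply: le_trans pq _.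
  by rewrite [leRHS](splitr d) lerD// hN0//=.
exact: le_lt_trans H (ltr_divD1M e0 Vab).
Qed.

(** Compare with regular sums of mesh at most [d - d'] and pass to the limit: the two meshes add up
    to at most [d], so the gap between [d'] and [d] costs nothing in [e]. Only a modulus of [F] and
    the increase of [V] enter, whence uniformity in a parameter. *)
Lemma rs_int_close F g V a b d d' e x t N : a <= b -> unif_cont F -> dominated g V ->
  d' < d -> (forall p q, `|p - q| <= d -> `|F p - F q| <= e) ->
  tagged_partition a b d' x t N ->
  `|stieltjes_sum F g x t N - rs_int F g a b| <= e * (V b - V a).
Proof.
move=> ab ucF gV d'd osc P.
have H : `|stieltjes_sum F g x t N - regular_sum F g a b M| @[M --> \oo] -->
    `|stieltjes_sum F g x t N - rs_int F g a b|.
  by apply: cvg_norm; apply: cvgB; [exact: cvg_cst|exact: cvg_regular_sum ab ucF gV].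
apply: (cvgr_to_le H).
apply: filterS (regular_mesh_small a b (_ : 0 < d - d')); last by rewrite subr_gt0.
move=> M hM; apply: stieltjes_sum_close P (regular_partitionP _ ab) gV _.
by move=> p q pq; apply: osc; apply: le_trans pq _; rewrite -lerBrDl.
Qed.

Lemma rs_int_cat F g V a b c : a <= b -> b <= c -> unif_cont F -> dominated g V ->
  rs_int F g a c = rs_int F g a b + rs_int F g b c.
Proof.
move=> ab bc ucF gV.
apply/eqP; rewrite -subr_eq0 -normr_le0; apply/ler_addgt0Pl => e e0.
rewrite addr0.
have Vab : 0 <= V b - V a by apply: le_trans (normr_ge0 _) (gV _ _ ab).
have Vbc : 0 <= V c - V b by apply: le_trans (normr_ge0 _) (gV _ _ bc).
(* Three comparisons, on [[a, b]], [[b, c]] and [[a, c]], cost [V b - V a], [V c - V b] and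
   [V c - V a]: twice [V c - V a] in total. *)
have W0 : 0 < (V c - V a) *+ 2 + 1.
  rewrite ltr_wpDl// mulrn_wge0//; lra.
have e'0 : 0 < e / ((V c - V a) *+ 2 + 1) by rewrite divr_gt0.
have [d d0 osc] := ucF _ e'0.
have d20 : 0 < d / 2 by rewrite divr_gt0.
have [n1 _ h1] := regular_mesh_small a b d20.
have [n2 _ h2] := regular_mesh_small b c d20.
have d2d : d / 2 < d by rewrite ltr_pdivrMr// ltr_pMr// ltr1n.
have {}h1 := h1 n1 (leqnn _); have {}h2 := h2 n2 (leqnn _).
set x := regular_partition a b n1; set y := regular_partition b c n2.
have widen p q dd u N : dd <= d / 2 -> tagged_partition p q dd u u N ->
    tagged_partition p q (d / 2) u u N.
  by move=> dd2 [? ? H]; split=> // i /H[? h]; split=> //; exact: le_trans h dd2.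
have Px : tagged_partition a b (d / 2) x x n1.+1 := widen _ _ _ _ _ h1 (regular_partitionP n1 ab).
have Py : tagged_partition b c (d / 2) y y n2.+1 := widen _ _ _ _ _ h2 (regular_partitionP n2 bc).
have e1 := rs_int_close ab ucF gV d2d osc Px.
have e2 := rs_int_close bc ucF gV d2d osc Py.
(* The glued partition: at index [n1.+1] both pieces have the node [b], and the tags pass to [y]. *)
pose z i := if (i <= n1.+1)%N then x i else y (i - n1.+1)%N.
have zr i : z (n1.+1 + i)%N = y i.
  rewrite /z addKn; case: i => [|i]; last by rewrite addnS ltnNge leq_addr.
  by rewrite addn0 leqnn; case: Px => _ -> _; case: Py => ->.
pose s i := if (i < n1.+1)%N then x i else y (i - n1.+1)%N.
have Pz : tagged_partition a c (d / 2) z s (n1.+1 + n2.+1).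
  split; first by rewrite /z leq0n; case: Px.
    by rewrite zr; case: Py.
  move=> i iN; have [i1|i1] := ltnP i n1.+1.
    by rewrite /z /s (ltnW i1) i1; case: Px => _ _; apply.
  rewrite -(subnKC i1) -addnS !zr /s ltnNge leq_addr /= addKn.
  by case: Py => _ _; apply; rewrite ltn_subLR.
have := rs_int_close (le_trans ab bc) ucF gV d2d osc Pz.
have -> : stieltjes_sum F g z s (n1.+1 + n2.+1) =
    stieltjes_sum F g x x n1.+1 + stieltjes_sum F g y y n2.+1.
  rewrite /stieltjes_sum big_split_ord /=; congr (_ + _); apply: eq_bigr => i _.
    by rewrite /z /s ltn_ord (ltnW (ltn_ord i)).
  by rewrite -addnS !zr /s ltnNge leq_addr /= addKn.
move: e1 e2; rewrite -/x -/y.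
set X := stieltjes_sum _ _ x _ _; set Y := stieltjes_sum _ _ y _ _ => e1 e2 e3.
apply: (@le_trans _ _ (e / ((V c - V a) *+ 2 + 1) * ((V c - V a) *+ 2))).
  rewrite mulrnAr mulr2n -[X in _ <= X + _](_ : e / ((V c - V a) *+ 2 + 1) * (V b - V a) +
    e / ((V c - V a) *+ 2 + 1) * (V c - V b) = _); last by rewrite -mulrDr; congr (_ * _); ring.
  move: e1 e2 e3; rewrite !ler_norml => /andP[? ?] /andP[? ?] /andP[? ?].
  by apply/andP; split; lra.
by apply/ltW/ltr_divD1M => //; rewrite mulrn_wge0//; lra.
Qed.

Lemma rs_int_eq F1 F2 g1 g2 a b : a <= b ->
  (forall p, a <= p <= b -> F1 p = F2 p) ->
  (forall p, a <= p <= b -> g1 p = g2 p) ->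
  rs_int F1 g1 a b = rs_int F2 g2 a b.
Proof.
move=> ab EF Eg; congr (limn _); apply/funext => N; apply: eq_bigr => i _.
have B := tagged_partition_bounds (regular_partitionP N ab).
by rewrite EF ?Eg ?B// ltnW.
Qed.

(** Regular partitions move with the interval, so the sums agree term by term. *)
Lemma rs_int_shift F g a b c :
  rs_int (fun p => F (p - c)) g (a + c) (b + c) = rs_int F (fun p => g (p + c)) a b.
Proof.
congr (limn _); apply/funext => N.
have E i : regular_partition (a + c) (b + c) N i = regular_partition a b N i + c.
  by rewrite /regular_partition; ring.
by apply: eq_bigr => i _; rewrite !E addrK.
Qed.

Lemma rs_int_regular_cst F g a b l :
  (forall N, regular_sum F g a b N = l) -> rs_int F g a b = l.
Proof.
move=> h; rewrite /rs_int (_ : regular_sum F g a b = fun=> l); last exact/funext.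
exact: (@lim_cst _ (@Rhausdorff R)).
Qed.

Lemma rs_int0 g a b : rs_int (fun=> 0) g a b = 0.
Proof.
apply: rs_int_regular_cst => N; rewrite /regular_sum /stieltjes_sum big1// => i _.
by rewrite mul0r.
Qed.

(** Only the first cell sees [g] change, and its tag is [a]; so every regular sum already has this
    value. *)
Lemma rs_int_jump F g a b l : a < b -> (forall p, a < p <= b -> g p = l) ->
  rs_int F g a b = F a * (l - g a).
Proof.
move=> ab gl.
apply: rs_int_regular_cst => N; rewrite /regular_sum /stieltjes_sum.
have x0 : regular_partition a b N 0 = a.
  by rewrite /regular_partition mul0r mulr0 addr0.
have xS i : (i <= N)%N -> a < regular_partition a b N i.+1 <= b.
  move=> iN; have := tagged_partition_bounds (regular_partitionP N (ltW ab)) (_ : i.+1 <= N.+1)%N.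
  move=> /(_ iN)/andP[_ ->]; rewrite andbT /regular_partition.
  by rewrite ltrDl mulr_gt0 ?subr_gt0// divr_gt0.
rewrite big_ord_recl x0 (gl _ (xS _ _))// big1 ?addr0// => i _.
by rewrite lift0 !gl ?xS ?subrr ?mulr0// ltnW// ltn_ord.
Qed.

Lemma rs_int_le F g V a b C : a <= b -> unif_cont F -> dominated g V ->
  (forall p, `|F p| <= C) -> `|rs_int F g a b| <= C * (V b - V a).
Proof.
move=> ab ucF gV FC.
apply: (cvgr_to_le (cvg_norm (cvg_regular_sum ab ucF gV))); near=> N.
have [x0 xN xt] := regular_partitionP N ab.
have -> : V b - V a =
    \sum_(i < N.+1) (V (regular_partition a b N i.+1) - V (regular_partition a b N i)).
  have := telescope_sumr (fun i => V (regular_partition a b N i)) (leq0n N.+1).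
  by rewrite x0 xN big_mkord.
rewrite mulr_sumr; apply: le_trans (ler_norm_sum _ _ _) _; apply: ler_sum => i _.
rewrite normrM ler_pM// gV//; have [/andP[h1 h2] _] := xt _ (ltn_ord i).
exact: le_trans h2.
Unshelve. all: by end_near. Qed.

End stieltjes_sums.

(** * Link with the integral defined by tagged sums *)

Section riemann_stieltjes.
Context {R : realType}.
Implicit Types (F g V : R -> R) (a b d e : R).

Lemma tags_ok_tagged_partition a b d s (t : nat -> R) :
  itv_partition a b s -> tags_ok a s t -> mesh a s < d ->
  tagged_partition a b d (nth 0 (a :: s)) t (size s).
Proof.
move=> [pth /eqP lst] tg md; split=> //; first by rewrite -last_nth.
move=> i iN; split; first exact: tg.
apply: le_trans (ltW md); rewrite /mesh.
exact: (le_bigmax 0 (fun i : 'I_(size s) =>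
  nth 0 (a :: s) i.+1 - nth 0 (a :: s) i) (Ordinal iN)).
Qed.

(** Agreement on [[a, b]] is enough because all nodes and tags lie there; [F] and [g] are meant to
    be extensions to the line. *)
Lemma is_RS_rs_int F g V F' g' a b : a <= b -> unif_cont F -> dominated g V ->
  (forall p, a <= p <= b -> F' p = F p) ->
  (forall p, a <= p <= b -> g' p = g p) ->
  is_RS F' g' a b (rs_int F g a b).
Proof.
move=> ab ucF gV EF Eg e e0.
have Vab : 0 <= V b - V a by apply: le_trans (normr_ge0 _) (gV _ _ ab).
have [d d0 osc] := ucF _ (divr_gt0 e0 (ltr_wpDl Vab ltr01)).
exists (d / 2); first by rewrite divr_gt0.
move=> s t sp st sd.
have P := tags_ok_tagged_partition sp st sd.
have -> : RS_sum F' g' a s t = stieltjes_sum F g (nth 0 (a :: s)) t (size s).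
  have B := tagged_partition_bounds P.
  apply: eq_bigr => i _.
  have /andP[B1 B2] := B i (ltnW (ltn_ord i)); have /andP[B3 B4] := B i.+1 (ltn_ord i).
  have /andP[t1 t2] := st _ (ltn_ord i).
  by rewrite EF ?(le_trans B1)//= ?(le_trans t2)//= !Eg ?B ?B1 ?B3// ltnW.
apply: le_lt_trans (ltr_divD1M e0 Vab); apply: (rs_int_close ab ucF gV _ osc P).
by rewrite ltr_pdivrMr// ltr_pMr// ltr1n.
Qed.

End riemann_stieltjes.

(** * Lebesgue integrals of a weight times a bounded function *)

Section real_integral.
Context d (T : measurableType d) (R : realType) (mu : {measure set T -> \bar R}).
Variables (D : set T) (mD : measurable D).
Implicit Types (f g w : T -> R) (K : R).

Lemma integrable_mul_bounded w f K : mu.-integrable D (EFin \o w) ->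
  measurable_fun D f -> (forall x, D x -> `|f x| <= K) ->
  mu.-integrable D (EFin \o (fun x => w x * f x)).
Proof.
move=> iw mf fK.
have /integrableP[/measurable_EFinP mw _] := iw.
apply: (@le_integrable _ _ _ mu _ mD _ (fun x => K%:E * (EFin \o w) x)%E).
- by apply/measurable_EFinP; exact: measurable_funM.
- move=> x Dx; rewrite /= lee_fin normrM mulrC normrM ler_wpM2r//.
  by apply: le_trans (fK _ Dx) (ler_norm _).
- exact: integrableZl.
Qed.

Lemma Rintegral_sum I (r : seq I) (f : I -> T -> R) :
  (forall i, mu.-integrable D (EFin \o f i)) ->
  (\int[mu]_(x in D) \sum_(i <- r) f i x)%R = \sum_(i <- r) (\int[mu]_(x in D) f i x)%R.
Proof.
move=> fi; elim: r => [|i r IH].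
  rewrite big_nil; under eq_Rintegral do rewrite big_nil.
  by rewrite Rintegral_cst// mul0r.
rewrite big_cons -IH -RintegralD//; first by apply: eq_Rintegral => x _; rewrite big_cons.
rewrite (_ : _ \o _ = fun x => (\sum_(i <- r) (f i x)%:E)%E).
  by apply: integrable_sum => // j _; exact: fi.
by apply/funext => x /=; rewrite sumEFin.
Qed.

Lemma norm_Rintegral_mul_le w f K : mu.-integrable D (EFin \o w) ->
  measurable_fun D f -> (forall x, D x -> `|f x| <= K) ->
  `|\int[mu]_(x in D) (w x * f x)| <= K * \int[mu]_(x in D) `|w x|.
Proof.
move=> iw mf fK; have iwf := integrable_mul_bounded iw mf fK.
have iaw : mu.-integrable D (EFin \o (fun x => `|w x|)) by exact: integrable_norm.
apply: le_trans (le_normr_Rintegral mD iwf) _; rewrite -RintegralZl//.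
apply: le_Rintegral => //.
- exact: (integrable_norm iwf).
- exact: (integrableZl mD K iaw).
- by move=> x Dx /=; rewrite normrM mulrC ler_wpM2r// fK.
Qed.

End real_integral.

(* Interchange of an integral over a parameter with a Stieltjes integral: it holds for
   the Stieltjes sums, which converge uniformly in the parameter. *)
Section parametric_stieltjes.
Context {R : realType}.
Local Notation mu := (@lebesgue_measure R).
Variables (D : set R) (w : R -> R) (Fu gu Vu : R -> R -> R) (F G : R -> R) (a b C K : R).
Hypotheses (ab : a <= b) (mD : measurable D) (iw : mu.-integrable D (EFin \o w)).
Hypothesis Fu_equi : forall e : R, 0 < e -> exists2 d, 0 < d &
  forall u p q, `|p - q| <= d -> `|Fu u p - Fu u q| <= e.
Hypothesis FuK : forall u p, `|Fu u p| <= K.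
Hypothesis guV : forall u, dominated (gu u) (Vu u).
Hypothesis VuC : forall u, D u -> Vu u b - Vu u a <= C.
Hypothesis mFu : forall p, measurable_fun D (Fu^~ p).
Hypothesis mgu : forall p, measurable_fun D (gu^~ p).
(** Stated for the product, so that the parameter may sit in the integrator (for the right-sided
    integral of [phi]) or in the integrand (for the primitive of the left-sided integral of [f]). *)
Hypothesis FG : forall t p q, a <= t <= b -> a <= p <= b -> a <= q <= b ->
  F t * (G q - G p) = \int[mu]_(u in D) (w u * (Fu u t * (gu u q - gu u p))).

Let ucFu u : unif_cont (Fu u).
Proof. by move=> e /Fu_equi[d d0 h]; exists d => // p q; exact: h. Qed.

Let measurable_sumu x t N : measurable_fun D (fun u => stieltjes_sum (Fu u) (gu u) x t N).
Proof.
apply: measurable_sum => i; apply: measurable_funM => //.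
exact: measurable_funB.
Qed.

(** A pointwise limit of regular sums, each measurable in [u]. *)
Lemma measurable_rs_int : measurable_fun D (fun u => rs_int (Fu u) (gu u) a b).
Proof.
apply: (measurable_fun_cvg (fun N => measurable_sumu _ _ _)) => u Du.
exact: cvg_regular_sum (ucFu u) (guV u).
Qed.

Lemma rs_int_bound u : D u -> `|rs_int (Fu u) (gu u) a b| <= K * C.
Proof.
move=> Du; apply: le_trans (rs_int_le ab (ucFu u) (guV u) (FuK u)) _.
by rewrite ler_wpM2l// ?VuC// (le_trans (normr_ge0 _) (FuK u a)).
Qed.

Lemma integrable_rs_int :
  mu.-integrable D (EFin \o (fun u => w u * rs_int (Fu u) (gu u) a b)).
Proof.
apply: (@integrable_mul_bounded _ _ _ mu _ mD _ _ (K * C) iw).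
  exact: measurable_rs_int.
exact: rs_int_bound.
Qed.

Lemma is_RS_param :
  is_RS F G a b (\int[mu]_(u in D) (w u * rs_int (Fu u) (gu u) a b)).
Proof.
move=> e e0.
pose W := \int[mu]_(u in D) `|w u|.
have W0 : 0 <= W by apply: Rintegral_ge0.
(* Only a point of [D] forces [0 <= C]. If [D] is empty, the integral vanishes and, through [FG], so
   does the sum. *)
have [D0|/set0P[u0 Du0]] := eqVneq D set0.
  exists 1 => // s t sp st _.
  rewrite (_ : RS_sum F G a s t = 0) ?D0 ?Rintegral_set0 ?subrr ?normr0//.
  have P := tags_ok_tagged_partition sp st (ltr_pwDr ltr01 (lexx _)).
  have B := tagged_partition_bounds P.
  apply: big1 => i _.
  have /andP[B1 B2] := B i (ltnW (ltn_ord i)); have /andP[B3 B4] := B i.+1 (ltn_ord i).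
  have /andP[t1 t2] := st _ (ltn_ord i).
  by rewrite FG ?D0 ?Rintegral_set0// ?B1 ?B3// (le_trans B1)//= (le_trans t2).
have C0 : 0 <= C.
  by apply: le_trans (VuC Du0); apply: le_trans (normr_ge0 _) (guV u0 ab).
have CW0 := mulr_ge0 C0 W0.
have [d d0 osc] := Fu_equi (divr_gt0 e0 (ltr_wpDl CW0 ltr01)).
exists (d / 2); first by rewrite divr_gt0.
move=> s t sp st sd.
have P := tags_ok_tagged_partition sp st sd.
set x := nth 0 (a :: s) in P; set N := size s in P.
(* The increment of [gu u] over one cell is at most the increase of [Vu u] over [[a, b]], hence the
   bound [K * C]. *)
have iwi (i : 'I_N) : mu.-integrable D (EFin \o (fun u =>
    w u * (Fu u (t i) * (gu u (x i.+1) - gu u (x i))))).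
  have mf : measurable_fun D (fun u => Fu u (t i) * (gu u (x i.+1) - gu u (x i))).
    by apply: measurable_funM => //; exact: measurable_funB.
  apply: (@integrable_mul_bounded _ _ _ mu _ mD _ _ (K * C)) => //.
  move=> u Du; rewrite normrM ler_pM//.
  have B := tagged_partition_bounds P.
  have /andP[B1 B2] := B i (ltnW (ltn_ord i)); have /andP[B3 B4] := B i.+1 (ltn_ord i).
  have xx : x i <= x i.+1 by have /andP[t1 /(le_trans t1)] := st _ (ltn_ord i).
  apply: le_trans (guV u xx) _; apply: le_trans (VuC Du).
  have := le_trans (normr_ge0 _) (guV u B1); have := le_trans (normr_ge0 _) (guV u B4).
  lra.
have iS : mu.-integrable D (EFin \o (fun u => w u * stieltjes_sum (Fu u) (gu u) x t N)).
  rewrite (_ : _ \o _ = fun u => (\sum_(i < N)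
    (w u * (Fu u (t i) * (gu u (x i.+1) - gu u (x i))))%:E)%E).
    by apply: integrable_sum => // i _; exact: iwi.
  by apply/funext => u /=; rewrite sumEFin /stieltjes_sum mulr_sumr.
have -> : RS_sum F G a s t = \int[mu]_(u in D) (w u * stieltjes_sum (Fu u) (gu u) x t N).
  under eq_Rintegral do rewrite /stieltjes_sum mulr_sumr.
  rewrite Rintegral_sum//; apply: eq_bigr => i _.
  have B := tagged_partition_bounds P.
  have /andP[B1 B2] := B i (ltnW (ltn_ord i)); have /andP[B3 B4] := B i.+1 (ltn_ord i).
  have /andP[t1 t2] := st _ (ltn_ord i).
  by rewrite FG ?B1 ?B3// (le_trans B1)//= (le_trans t2).
rewrite -RintegralB//; last exact: integrable_rs_int.
under eq_Rintegral do rewrite -mulrBr.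
(* The error is at most [e / (C * W + 1) * C] for each [u], and [|w|] has mass [W]. *)
apply: le_lt_trans (ltr_divD1M e0 CW0); rewrite mulrA.
have mf : measurable_fun D
    (fun u => stieltjes_sum (Fu u) (gu u) x t N - rs_int (Fu u) (gu u) a b).
  by apply: measurable_funB; [exact: measurable_sumu|exact: measurable_rs_int].
apply: norm_Rintegral_mul_le => //.
move=> u Du; apply: le_trans (_ : e / (C * W + 1) * (Vu u b - Vu u a) <= _).
  apply: (rs_int_close ab (ucFu u) (guV u) _ (osc u) P).
  by rewrite ltr_pdivrMr// ltr_pMr// ltr1n.
by rewrite ler_wpM2l ?VuC// divr_ge0// ltW// ltr_wpDl.
Qed.

End parametric_stieltjes.

(** * Uniformly continuous extension to the line *)

Section uniform_continuity.
Context {R : realType}.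
Implicit Types (F : R -> R) (a b e : R).

(** For [a <= b], the retraction of the line onto [[a, b]]. Being 1-Lipschitz, it carries a modulus
    of continuity over to the extension by boundary values. *)
Definition clip a b p : R := Num.max a (Num.min p b).

Lemma clip_itv a b p : a <= b -> a <= clip a b p <= b.
Proof. by move=> ab; rewrite /clip le_max lexx /= ge_max ab ge_min lexx orbT. Qed.

Lemma clip_id a b p : a <= p <= b -> clip a b p = p.
Proof. by move=> /andP[ap pb]; rewrite /clip min_l// max_r. Qed.

Lemma clip_le a b p q : p <= q -> clip a b p <= clip a b q.
Proof.
move=> pq; rewrite /clip ge_max !le_max lexx /=; apply/orP; right.
by rewrite le_min !ge_min pq lexx orbT.
Qed.

Lemma clip_lipschitz a b p q : `|clip a b p - clip a b q| <= `|p - q|.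
Proof.
wlog pq : p q / p <= q.
  by move=> h; case: (leP p q) => [|/ltW] /h //; rewrite distrC (distrC p).
rewrite !ler0_norm ?subr_le0//; last exact: clip_le.
rewrite /clip; case: (leP p b) => ?; case: (leP q b) => ?.
all: do ?[case: (leP a) => ?]; lra.
Qed.

Lemma unif_cont_clip F a b : {within `[a, b], continuous F} -> unif_cont (F \o clip a b).
Proof.
move=> /subspace_continuousP cF e e0.
have [ab|ba] := leP a b; last first.
  have ca p : clip a b p = a by apply: max_l; rewrite ge_min (ltW ba) orbT.
  by exists 1 => // p q _ /=; rewrite !ca subrr normr0 ltW.
(* Heine-Cantor, with compactness in filter form: around each [x], [P d y] holds for all [y] near
   [x] and all small [d], so one [d] serves all of [[a, b]]. *)
pose P (d x : R) := a <= x <= b -> forall q, a <= q <= b -> `|x - q| <= d -> `|F x - F q| <= e.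
have : \forall d \near 0^'+, `[a, b] `<=` P d.
  apply: ((compact_near_coveringP _).1 (@segment_compact R a b)) => x xab.
  have /cvgrPdist_lt /(_ (e / 2)) := cF x xab.
  rewrite divr_gt0// => /(_ isT); rewrite near_withinE => /nbhs_ballP[r /= r0 hr].
  exists (ball x (r / 2), [set d | d < r / 2]).
    split; first by apply: nbhsx_ballx; rewrite divr_gt0.
    by apply: nbhs_right_lt; rewrite divr_gt0.
  move=> [y d] /= [xy dr] yab q qab yq.
  have h1 : `|F x - F y| < e / 2.
    by apply: hr; rewrite /ball /=; [apply: lt_trans xy _; lra|rewrite in_itv].
  have h2 : `|F x - F q| < e / 2.
    apply: hr; rewrite /ball /=; last by rewrite in_itv.
    rewrite -(subrKA y); apply: le_lt_trans (ler_normD _ _) _.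
    move: xy; rewrite /ball /=; lra.
  rewrite -(subrKA (F x)); apply: le_trans (ler_normD _ _) _.
  by rewrite (distrC (F y)); lra.
move=> /nbhs_ballP[r /= r0 hr].
have r20 : 0 < r / 2 by rewrite divr_gt0.
exists (r / 2) => // p q pq /=.
apply: (hr (r / 2) _ r20); rewrite /ball/=.
- by rewrite sub0r normrN gtr0_norm//; lra.
- by rewrite in_itv /= clip_itv.
- exact: clip_itv.
- exact: clip_itv.
- exact: le_trans (clip_lipschitz _ _ _ _) pq.
Qed.

Lemma bounded_clip F a b : a <= b -> {within `[a, b], continuous F} ->
  exists K, forall p, `|(F \o clip a b) p| <= K.
Proof.
move=> ab cF; have [c1 _ h1] := EVT_max ab cF; have [c2 _ h2] := EVT_min ab cF.
exists (`|F c1| + `|F c2|) => p /=.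
have pab : clip a b p \in `[a, b] by rewrite in_itv /= clip_itv.
have := h1 _ pab; have := h2 _ pab; have := ler_norm (F c1).
have := ler_norm (- F c2); rewrite normrN ler_norml => *.
have := normr_ge0 (F c1); have := normr_ge0 (F c2).
by move=> *; apply/andP; split; lra.
Qed.

End uniform_continuity.

(** * Extension of functions of bounded variation *)

Section bounded_variation_extension.
Context {R : realType}.
Implicit Types (g V phi : R -> R) (a b : R).

(** [g] is the difference of the nondecreasing functions [g + V] and [V]. *)
Lemma dominated_measurable g V (D : set R) : measurable D -> dominated g V ->
  measurable_fun D g.
Proof.
move=> mD gV.
have mV : measurable_fun D V.
  apply: nondecreasing_measurable => // p q pq.
  by rewrite -subr_ge0; apply: le_trans (normr_ge0 _) (gV _ _ pq).
have mgV : measurable_fun D (g \+ V).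
  apply: nondecreasing_measurable => // p q pq /=.
  by have := gV _ _ pq; rewrite ler_norml => /andP[? ?]; lra.
rewrite (_ : g = (g \+ V) \- V); first exact: measurable_funB.
by apply/funext => p /=; rewrite addrK.
Qed.

(** The value 0 beyond [b] lets the right-sided integrals run over a parameter range independent of
    the point; the price is a jump at [b]. *)
Definition extend_bv a b phi p : R := if p <= b then phi (clip a b p) else 0.

Lemma extend_bv_dominated a b phi : a <= b -> bounded_variation a b phi ->
  exists V C, [/\ dominated (extend_bv a b phi) V, (forall p q, V q - V p <= C) &
    forall p, `|extend_bv a b phi p| <= C].
Proof.
move=> ab BV.
have fin p : a <= p <= b -> total_variation a p phi \is a fin_num.
  move=> /andP[ap pb]; apply/bounded_variationP => //.
  exact: bounded_variationl BV.
pose T p := fine (total_variation a (clip a b p) phi).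
have TB p q : p <= q -> `|phi (clip a b q) - phi (clip a b p)| <= T q - T p.
  move=> pq; have := clip_itv p ab; have := clip_itv q ab; have := clip_le a b pq.
  set cp := clip a b p; set cq := clip a b q => cpq /andP[aq qb] /andP[ap pb].
  rewrite /T -/cp -/cq (total_variationD phi ap cpq) fineD ?fin ?ap//; last first.
    apply/bounded_variationP => //.
    by apply: (bounded_variationr ap cpq); exact: bounded_variationl BV.
  rewrite addrAC subrr add0r -lee_fin fineK ?total_variation_ge//.
  apply/bounded_variationP => //.
  by apply: (bounded_variationr ap cpq); exact: bounded_variationl BV.
have T0 p : 0 <= T p <= T b.
  apply/andP; split; first by rewrite fine_ge0// total_variation_ge0//; case/andP: (clip_itv p ab).
  have [pb|/ltW bp] := leP p b.
    by rewrite -subr_ge0; apply: le_trans (normr_ge0 _) (TB _ _ pb).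
  rewrite /T (_ : clip a b p = clip a b b)// /clip min_r// min_l//.
(* The variation up to the clipped point, plus the size of the jump at [b]. The term [|phi a|] makes
   the same constant bound the function itself. *)
exists (fun p => T p + (if p <= b then 0 else `|phi b|)), (T b + `|phi b| + `|phi a|).
split.
- move=> p q pq; rewrite /extend_bv.
  have [qb|bq] := leP q b.
    by rewrite (le_trans pq qb) !addr0; exact: TB.
  have [pb|bp] := leP p b; last first.
    rewrite !subrr normr0.
    by have := TB _ _ pq; have := normr_ge0 (phi (clip a b q) - phi (clip a b p)); lra.
  have := TB _ _ pq; rewrite (_ : clip a b q = b); last first.
    by rewrite /clip (min_r (ltW bq)) max_r.
  rewrite sub0r normrN addr0 => h.
  have := ler_normB (phi b) (phi b - phi (clip a b p)); rewrite subKr; lra.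
- move=> p q; have /andP[? ?] := T0 p; have /andP[? ?] := T0 q.
  have := normr_ge0 (phi b); have := normr_ge0 (phi a).
  by case: ifP => _; case: ifP => _; lra.
- move=> p; have /andP[? ?] := T0 p; have /andP[? ?] := T0 a; rewrite /extend_bv.
  have := normr_ge0 (phi b); have := normr_ge0 (phi a).
  case: ifP => [pb|_]; last by rewrite normr0; lra.
  have [ap|/ltW pa] := leP a p.
    have := TB _ _ ap; rewrite (_ : clip a b a = a); last by rewrite clip_id// lexx.
    have := ler_normD (phi (clip a b p) - phi a) (phi a); rewrite subrK; lra.
  by rewrite (_ : clip a b p = a); [lra|rewrite /clip (min_l pb) max_l].
Qed.

End bounded_variation_extension.

(** * Integrability of powers; reflections and translations *)

Section lebesgue_tools.
Context {R : realType}.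
Local Notation mu := (@lebesgue_measure R).

(** On [[c / i.+2, c]] the n-th power is an antiderivative of the integrand times [n], so these
    integrals stay below the n-th power of [c]; monotone convergence concludes. The [i.+2] keeps the
    intervals nondegenerate. *)
Lemma integrable_powR (c n : R) : 0 < n -> 0 < c ->
  mu.-integrable `]0, c] (EFin \o (fun u => u `^ (n - 1))).
Proof.
move=> n0 c0.
have mp : measurable_fun `]0, c] (fun u : R => u `^ (n - 1)) by exact: measurable_funTS.
suff : (\int[mu]_(u in `]0%R, c]) (n * u `^ (n - 1))%:E < +oo)%E.
  move=> h; have : mu.-integrable `]0, c] (EFin \o (fun u => n * u `^ (n - 1))).
    apply/integrableP; split; first by apply/measurable_EFinP; exact: measurable_funM.
    apply: le_lt_trans h; apply: ge0_le_integral => //=.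
    - by do 2 apply: measurableT_comp => //; exact: measurable_funM.
    - by apply/measurable_EFinP; exact: measurable_funM.
    - by move=> u _; rewrite lee_fin ger0_norm// mulr_ge0 ?powR_ge0// ltW.
  move=> /(@integrableZl _ _ _ mu _ (measurable_itv _) n^-1).
  congr (is_true (integrable _ _ _)); apply/funext => u /=.
  by rewrite -EFinM mulKf// gt_eqF.
pose I (i : nat) : set R := `[c / i.+2%:R, c]%classic.
have UI : \bigcup_i I i = `]0, c]%classic.
  apply/seteqP; split => u.
    move=> [i _]; rewrite /I /= !in_itv /= => /andP[h ->]; rewrite andbT.
    by apply: lt_le_trans h; rewrite divr_gt0.
  rewrite /= in_itv /= => /andP[u0 uc]; exists (Num.trunc (c / u)) => //.
  rewrite /I /= in_itv /= uc andbT ler_pdivrMr// -ler_pdivrMl// mulrC ltW//.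
  by apply: lt_le_trans (truncnS_gt _) _; rewrite ler_nat.
rewrite -UI.
have cvI := @ge0_nondecreasing_set_cvg_integral _ (measurableTypeR R) R I
  (fun u => (n * u `^ (n - 1))%:E) mu.
have {cvI} : (\int[mu]_(u in I i) (n * u `^ (n - 1))%:E)%E @[i --> \oo] -->
    (\int[mu]_(u in \bigcup_i I i) (n * u `^ (n - 1))%:E)%E.
  apply: cvI.
  - apply/nondecreasing_seqP => i; rewrite subsetEset => u; rewrite /I /= !in_itv /=.
    move=> /andP[h ->]; rewrite andbT; apply: le_trans h.
    by rewrite ler_pM2l// lef_pV2 ?posrE// ler_nat.
  - by move=> i; exact: measurable_itv.
  - by move=> i; apply/measurable_EFinP; apply: measurable_funM => //; exact: measurable_funTS.
  - by move=> i u _; rewrite lee_fin mulr_ge0 ?powR_ge0// ltW.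
move=> cvI; apply: (@le_lt_trans _ _ (c `^ n)%:E); last exact: ltry.
rewrite -(cvg_lim _ cvI)//; apply: lime_le; first by apply/cvg_ex; eexists; exact: cvI.
apply: nearW => i.
have d0 : 0 < c / i.+2%:R by rewrite divr_gt0.
have dc : c / i.+2%:R < c by rewrite ltr_pdivrMr// ltr_pMr// ltr1n.
have pos u : c / i.+2%:R <= u -> u \in `]0, +oo[.
  by move=> h; rewrite in_itv /= andbT (lt_le_trans d0).
have derw (r : R) (J : interval R) : (forall u, u \in J -> c / i.+2%:R <= u) ->
    {within [set` J], continuous (fun u : R => u `^ r)}.
  move=> hJ; apply: derivable_within_continuous => u /hJ /pos hu.
  exact: derivable_powR.
have cp : {within `[c / i.+2%:R, c], continuous (fun u : R => u `^ n)}.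
  by apply: derw => u; rewrite in_itv => /andP[].
rewrite (continuous_FTC2 dc (F := fun u => u `^ n)).
- by rewrite -EFinB lee_fin gerBl powR_ge0.
- move=> u; apply: cvgM; first exact: cvg_cst.
  by apply: (derw (n - 1)) => v; rewrite in_itv => /andP[].
- have [_ cl cr] := (continuous_within_itvP _ dc).1 cp.
  split => // u; rewrite in_itv /= => /andP[du _].
  by apply: derivable_powR; exact/pos/ltW.
- move=> u; rewrite in_itv /= => /andP[du _].
  by rewrite powR_derive1//; exact/pos/ltW.
Qed.

(** By uniqueness of the measure, half-open intervals suffice; a reflection moves the closed end to
    the other side and keeps the length. *)
Lemma lebesgue_measure_reflect (c : R) (A : set R) : measurable A ->
  pushforward mu ((fun t => c - t) : _ -> measurableTypeR R) A = mu A.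
Proof.
move=> mA; apply/esym/lebesgue_measure_unique => //=.
  exact: (measurable_funB (measurable_cst c) (@measurable_id _ R setT)).
move=> _ _ [[p q]] _ <-.
rewrite /pushforward.
rewrite (_ : _ @^-1` _ = `[c - q, c - p[%classic); last first.
  by apply/seteqP; split => t /=; rewrite !in_itv /= => /andP[? ?]; apply/andP; split; lra.
rewrite !lebesgue_measure_itv/= !lte_fin.
rewrite ltrD2l ltrN2; case: ifP => // _; rewrite -!EFinB; congr EFin; ring.
Qed.

Lemma integral_reflect (c : R) (f : R -> \bar R) : measurable_fun setT f ->
  (\int[mu]_t f (c - t)%R = \int[mu]_t f t)%E.
Proof.
move=> mf.
have mr : measurable_fun setT ((fun t => c - t) : R -> measurableTypeR R).
  exact: (measurable_funB (measurable_cst c) (@measurable_id _ R setT)).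
have ge0 (g : R -> \bar R) : measurable_fun setT g -> (forall t, 0 <= g t)%E ->
    (\int[mu]_t g (c - t)%R = \int[mu]_t g t)%E.
  move=> mg g0; have := @ge0_integral_pushforward _ _ (measurableTypeR R) (measurableTypeR R) R
    _ mr mu setT g measurableT mg (fun y _ => g0 y).
  rewrite preimage_setT => <-; apply: eq_measure_integral => A mA _.
  exact: lebesgue_measure_reflect.
pose r (t : R) := c - t; change (\int[mu]_t (f \o r) t = \int[mu]_t f t)%E.
rewrite [LHS]integralE [RHS]integralE; congr (_ - _)%E.
  rewrite -[RHS](ge0 _ (measurable_funepos mf) (fun t => funepos_ge0 f t)).
  by apply: eq_integral => t _; rewrite funepos_comp.
rewrite -[RHS](ge0 _ (measurable_funeneg mf) (fun t => funeneg_ge0 f t)).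
by apply: eq_integral => t _; rewrite funeneg_comp.
Qed.

(** A translation is a composite of two reflections. *)
Lemma integral_translate (c : R) (f : R -> \bar R) : measurable_fun setT f ->
  (\int[mu]_t f (t + c)%R = \int[mu]_t f t)%E.
Proof.
move=> mf; have mfc : measurable_fun setT (fun t : R => f (c - t)).
  by apply: measurableT_comp => //; exact: measurable_funB.
transitivity (\int[mu]_t f (c - (0 - t))%R)%E.
  by apply: eq_integral => t _; rewrite sub0r opprK addrC.
by rewrite (integral_reflect 0 mfc) (integral_reflect c mf).
Qed.

End lebesgue_tools.

(** * Fubini for convolutions *)

Section convolution.
Context {R : realType}.
Local Notation mu := (@lebesgue_measure R).

Lemma integrable_translate (g : R -> R) (c : R) : mu.-integrable setT (EFin \o g) ->
  mu.-integrable setT (EFin \o (fun t => g (t + c))).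
Proof.
move=> /integrableP[/measurable_EFinP mg ig].
have mgc : measurable_fun setT (fun t : R => g (t + c)).
  by apply: measurableT_comp => //; exact: measurable_funD.
apply/integrableP; split; first exact/measurable_EFinP.
rewrite (integral_translate c (f := fun t => (`|g t|)%:E))//.
by apply/measurable_EFinP; exact: measurableT_comp.
Qed.

(** The double integrand is integrable on the product because all translates of [g] have the same L1
    norm. *)
Lemma Rintegral_convolution (k g : R -> R) (A : set R) : measurable A ->
  mu.-integrable setT (EFin \o k) -> mu.-integrable setT (EFin \o g) ->
  mu.-integrable A (EFin \o (fun y => \int[mu]_u (k u * g (y - u)))) /\
  \int[mu]_(y in A) (\int[mu]_u (k u * g (y - u))) =
  \int[mu]_u (k u * \int[mu]_(y in A) g (y - u)).
Proof.
move=> mA ik ig.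
have /integrableP[/measurable_EFinP mk ik'] := ik.
have /integrableP[/measurable_EFinP mg ig'] := ig.
pose h (z : measurableTypeR R * measurableTypeR R) : \bar R :=
  (\1_A z.1 * (k z.2 * g (z.1 - z.2)))%:E.
have mh : measurable_fun setT h.
  apply/measurable_EFinP; apply: measurable_funM.
    apply: measurableT_comp; last exact: measurable_fst.
    exact: (@measurable_indic _ (measurableTypeR R)).
  apply: measurable_funM.
    by apply: (@measurableT_comp _ _ _ _ _ _ k) => //; exact: measurable_snd.
  apply: (@measurableT_comp _ _ _ _ _ _ g) => //.
  by apply: measurable_funB; [exact: measurable_fst|exact: measurable_snd].
have mgu (u : R) : measurable_fun setT (fun y : R => g (y - u)).
  by apply: measurableT_comp => //; exact: measurable_funB.
have igu (u : R) : mu.-integrable setT (EFin \o (fun y : R => g (y - u))).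
  exact: integrable_translate ig.
have iguA (u : R) : mu.-integrable A (EFin \o (fun y : R => g (y - u))).
  exact: integrableS (igu u).
have ih : (mu \x mu)%E.-integrable setT h.
  apply/(integrable21ltyP _ _ mh).
  have mag : measurable_fun setT (fun y : R => (`|g y|)%:E).
    by apply/measurable_EFinP; exact: measurableT_comp.
  have mak : measurable_fun setT (fun u : R => (`|k u|)%:E).
    by apply/measurable_EFinP; exact: measurableT_comp.
  apply: (@le_lt_trans _ _ (\int[mu]_u (\int[mu]_y `|g y|%:E * `|k u|%:E))%E).
    apply: ge0_le_integral => //.
    - by move=> u _; exact: integral_ge0.
    - apply: (measurable_fun_fubini_tonelli_G (abse \o h)).
        exact: measurableT_comp.
    - by move=> z; exact: abse_ge0.
    - exact: measurable_funeM.
    move=> u _; rewrite -(integral_translate (- u) mag) muleC.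
    rewrite -ge0_integralZl_EFin//; last first.
      by apply/measurable_EFinP; apply: measurableT_comp => //; exact: mgu.
    apply: ge0_le_integral => //.
    - apply/measurable_EFinP; apply: measurableT_comp => //; apply: measurable_funM.
        exact: (@measurable_indic _ (measurableTypeR R)).
      by apply: measurable_funM; [exact: (measurable_cst (k u))|exact: (mgu u)].
    - apply/measurable_EFinP; apply: measurable_funM; first exact: (measurable_cst `|k u|).
      by apply: measurableT_comp => //; exact: mgu.
    move=> y _; rewrite /h /= -EFinM lee_fin !normrM ler_piMl ?mulr_ge0//.
    by rewrite indicE; case: (_ \in _); rewrite ?normr1 ?normr0.
  rewrite ge0_integralZl//; last exact: integral_ge0.
  by apply: lte_mul_pinfty; rewrite ?integral_ge0// ge0_fin_numE ?integral_ge0.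
have hA (u : R) : (\int[mu]_y h (y, u) = (k u * \int[mu]_(y in A) g (y - u))%R%:E)%E.
  rewrite EFinM fineK; last exact: integrable_fin_num (iguA u).
  rewrite -integralZl//; last exact: iguA.
  rewrite [RHS]integral_mkcond; apply: eq_integral => y _.
  rewrite /h /= patchE indicE; case: ifPn => yA; first by rewrite mul1r EFinM.
  by rewrite mul0r.
have EA (y : R) : A y -> (\int[mu]_u h (y, u) = \int[mu]_u (k u * g (y - u))%:E)%E.
  by move=> Ay; apply: eq_integral => u _; rewrite /h /= indicE mem_set// mul1r.
have EnA (y : R) : ~ A y -> (\int[mu]_u h (y, u) = 0)%E.
  by move=> Ay; apply: integral0_eq => u _; rewrite /h /= indicE memNset// mul0r.
have iE := integrable_fubini_F ih.
have mfE : measurable_fun setT ((EFin \o fine) \o (fun y => \int[mu]_u h (y, u))%E).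
  apply: measurableT_comp; first exact/measurable_EFinP/fine_measurable.
  exact: measurable_int iE.
split.
  apply: (@eq_integrable _ _ _ mu _ mA
      ((EFin \o fine) \o (fun y => \int[mu]_u h (y, u))%E)).
    by move=> y /set_mem Ay; rewrite /= EA.
  apply: integrableS (_ : mu.-integrable setT _) => //.
  apply: le_integrable iE => // y _ /=.
  rewrite /fubini_F; move: (\int[mu]_u h (y, u))%E => [r| |] //=.
    by rewrite normr0 leey.
  by rewrite normr0 leey.
rewrite {3}/Rintegral.
under [in RHS]eq_integral do rewrite -hA.
rewrite -(Fubini ih) Rintegral_mkcond /Rintegral; congr fine.
(* [fine] sends an infinite inner integral to 0, so the two integrands agree only where it is
   finite, that is almost everywhere. *)
apply: ae_eq_integral => //.
- rewrite [X in measurable_fun _ X](_ : _ =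
      (EFin \o fine) \o (fun y => \int[mu]_u h (y, u))%E)//.
  apply/funext => y /=; rewrite patchE; case: ifPn => [/set_mem|/negP yA].
    by move=> Ay; rewrite EA.
  by rewrite EnA// => Ay; apply: yA; exact: mem_set.
- exact: measurable_int iE.
have := integrable_ae measurableT iE; apply: filterS => y /= /(_ I) fE _.
rewrite patchE; case: ifPn => [/set_mem|/negP yA].
  by move=> Ay; rewrite -EA// fineK.
by rewrite EnA// => Ay; apply: yA; exact: mem_set.
Qed.

End convolution.

(** * Fractional integrals of order below 1 as convolutions *)

Section fractional_integral.
Context {R : realType}.
Local Notation mu := (@lebesgue_measure R).
Variables (a b n : R).
Hypotheses (ab : a < b) (n0 : 0 < n) (n1 : n < 1).

(** The convention for powers of 0 gives the kernel the value 0 at its singularity, as for [k]; the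
    endpoint then needs no null-set argument. *)
Let pow0 : (0 : R) `^ (n - 1) = 0.
Proof. by rewrite powR0// subr_eq0 lt_eqF. Qed.

Let k := (fun u : R => u `^ (n - 1)) \_ `]0, b - a].

Let kE u : u \in `]0, b - a] -> k u = u `^ (n - 1).
Proof. by move=> h; rewrite /k patchE mem_set. Qed.

Let k0 u : u \notin `]0, b - a] -> k u = 0.
Proof. by move=> /negP h; rewrite /k patchE memNset. Qed.

Let ik : mu.-integrable setT (EFin \o k).
Proof.
rewrite -restrict_EFin; apply/integrable_restrict => //; rewrite setTI.
by apply: integrable_powR; rewrite ?subr_gt0.
Qed.

Let mk : measurable_fun setT k.
Proof. by have /integrableP[/measurable_EFinP] := ik. Qed.

Lemma Rintegral_kernel (h : R -> R) :
  \int[mu]_u (k u * h u) = \int[mu]_(u in `]0, b - a]) (u `^ (n - 1) * h u).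
Proof.
rewrite [RHS]Rintegral_mkcond; apply: eq_Rintegral => u _.
by rewrite /k !patchE; case: ifPn => //; rewrite mul0r.
Qed.

(** Exchange the integrals: the primitive of a translate of [f] is a translate of its primitive. As
    [f] enters the right side only through [prim a f], Alexiewicz limits can be taken there. *)
Lemma prim_RLJ_L1 (f : R -> R) x : mu.-integrable `[a, b] (EFin \o f) ->
  a <= x <= b ->
  prim a (RLJ_L1 a n f) x = (Gamma n)^-1 *
    \int[mu]_(u in `]0, b - a]) (u `^ (n - 1) * prim a f (x - u)).
Proof.
move=> jf /andP[ax xb].
pose g := f \_ `[a, b].
have ig : mu.-integrable setT (EFin \o g).
  by rewrite -restrict_EFin; apply/integrable_restrict => //; rewrite setTI.
have mg : measurable_fun setT g by have /integrableP[/measurable_EFinP] := ig.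
have [iX EX] := Rintegral_convolution (measurable_itv `[a, x]) ik ig.
have inner y : y \in `[a, x] ->
    \int[mu]_(t in `[a, y]) ((y - t) `^ (n - 1) * f t) = \int[mu]_u (k u * g (y - u)).
  rewrite in_itv /= => /andP[ay yx].
  have mh : measurable_fun setT (fun t : R => (k (y - t) * g t)%:E).
    apply/measurable_EFinP; apply: measurable_funM => //.
    by apply: measurableT_comp => //; exact: measurable_funB.
  have := integral_reflect y mh => E.
  rewrite Rintegral_mkcond /Rintegral; congr fine; transitivity (\int[mu]_t (k (y - t) * g t)%:E)%E.
    apply: eq_integral => t _; congr EFin; rewrite patchE.
    case: ifPn => [/set_mem|/negP h].
      rewrite /= in_itv /= => /andP[at_ ty].
      rewrite /g patchE mem_set; last by rewrite /= in_itv /= at_ (le_trans ty)// (le_trans yx).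
      have [->|tny] := eqVneq t y; first by rewrite subrr pow0 k0// in_itv /= ltxx.
      by rewrite kE// in_itv /= subr_gt0 lt_neqAle tny ty /=; lra.
    have [ty|yt] := leP t y; last first.
      by rewrite k0 ?mul0r// in_itv /= subr_gt0 ltNge (ltW yt).
    rewrite /g patchE memNset ?mulr0// => /=; rewrite in_itv /= => /andP[at_ tb].
    by apply: h; rewrite inE /= in_itv /= at_.
  by rewrite -E; apply: eq_integral => t _; rewrite subKr.
have -> : prim a (RLJ_L1 a n f) x =
    \int[mu]_(y in `[a, x]) ((Gamma n)^-1 * \int[mu]_u (k u * g (y - u))).
  by apply: eq_Rintegral => y /set_mem yx; rewrite /RLJ_L1 inner.
rewrite RintegralZl// EX Rintegral_kernel; congr (_ * _).
apply: eq_Rintegral => u /set_mem /=; rewrite in_itv /= => /andP[u0 uba]; congr (_ * _).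
rewrite Rintegral_mkcond /prim [RHS]Rintegral_mkcond /Rintegral; congr fine.
have mh : measurable_fun setT (fun t : R => (((fun y => g (y - u)) \_ `[a, x]) t)%:E).
  apply/measurable_EFinP; apply: (measurable_restrictT _ _).1 => //.
  by apply: measurable_funTS; apply: measurableT_comp => //; exact: measurable_funB.
rewrite -(integral_translate u mh); apply: eq_integral => t _; congr EFin.
rewrite [LHS]patchE [RHS]patchE addrK.
have [tx|tx] := boolP (t \in `[a, x - u]).
  have [h1 h2] : a <= t /\ t <= x - u by apply/andP; move: tx; rewrite in_itv.
  rewrite !mem_set//=; last by rewrite in_itv /=; apply/andP; split; lra.
  by rewrite /g patchE mem_set//= in_itv /=; apply/andP; split; lra.
rewrite [in RHS]memNset; last exact/negP.
case: ifPn => // /set_mem; rewrite /= in_itv /= => /andP[h1 h2].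
rewrite /g patchE memNset//= in_itv /= => /andP[h3 _].
by move: tx; rewrite in_itv /= h3 lerBrDr h2.
Qed.

(** The extension vanishes beyond [b], so the range [u <= b - p] may be enlarged to [u <= b - a].
    Domination gives measurability. *)
Lemma RLJ_right_frac (phi : R -> R) V p : dominated (extend_bv a b phi) V -> a <= p <= b ->
  RLJ_right b n phi p = (Gamma n)^-1 *
    \int[mu]_(u in `]0, b - a]) (u `^ (n - 1) * extend_bv a b phi (p + u)).
Proof.
move=> phiV /andP[ap pb]; rewrite /RLJ_right; congr (_ * _).
have mphi := dominated_measurable (@measurableT _ R) phiV.
rewrite -Rintegral_kernel Rintegral_mkcond /Rintegral; congr fine.
have mh : measurable_fun setT (fun t : R => (k (t - p) * extend_bv a b phi t)%:E).
  apply/measurable_EFinP; apply: measurable_funM => //.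
  by apply: measurableT_comp => //; exact: measurable_funB.
transitivity (\int[mu]_t (k (t - p) * extend_bv a b phi t)%:E)%E; last first.
  rewrite -(integral_translate p mh); apply: eq_integral => t _.
  by rewrite addrK addrC.
apply: eq_integral => t _; congr EFin; rewrite patchE.
case: ifPn => [/set_mem|/negP h].
  rewrite /= in_itv /= => /andP[pt tb].
  rewrite /extend_bv tb clip_id ?(le_trans ap)//.
  have [->|tnp] := eqVneq t p; first by rewrite subrr pow0 k0// in_itv /= ltxx.
  by rewrite kE// in_itv /= subr_gt0 lt_neqAle eq_sym tnp pt /=; lra.
have [pt|tp] := leP p t; last first.
  by rewrite k0 ?mul0r// in_itv /= subr_gt0 ltNge (ltW tp).
rewrite /extend_bv; case: ifPn => [tb|_]; last by rewrite mulr0.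
by exfalso; apply: h; rewrite inE /= in_itv /= pt.
Qed.

End fractional_integral.

(** * Measurability of primitives *)

Section primitive.
Context {R : realType}.
Local Notation mu := (@lebesgue_measure R).

Lemma prim_dominated (a : R) (g : R -> R) : mu.-integrable setT (EFin \o g) ->
  dominated (prim a g) (prim a (fun t => `|g t|)).
Proof.
move=> ig p q pq.
have iag : mu.-integrable setT (EFin \o (fun t => `|g t|)) by exact: integrable_norm.
have prim0 (f : R -> R) r : r < a -> prim a f r = 0.
  by move=> ra; rewrite /prim set_itv_ge ?Rintegral_set0//= bnd_simp -ltNge.
have igS A : measurable A -> mu.-integrable A (EFin \o g).
  by move=> mA; exact: integrableS ig.
have iagS A : measurable A -> mu.-integrable A (EFin \o (fun t => `|g t|)).
  by move=> mA; exact: integrableS iag.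
have [ap|pa] := leP a p; last first.
  rewrite !(prim0 _ p pa) !subr0; apply: le_normr_Rintegral => //.
  exact: igS.
rewrite /prim Rintegral_itvB//; last exact: igS.
rewrite Rintegral_itvB//; last exact: iagS.
apply: le_normr_Rintegral => //.
exact: igS.
Qed.

Lemma measurable_prim_reflect (a b : R) (f : R -> R) x (D : set R) : measurable D ->
  mu.-integrable `[a, b] (EFin \o f) -> (forall u, D u -> x - u <= b) ->
  measurable_fun D (fun u => prim a f (x - u)).
Proof.
move=> mD jf Db.
have ig : mu.-integrable setT (EFin \o (f \_ `[a, b])).
  by rewrite -restrict_EFin; apply/integrable_restrict => //; rewrite setTI.
have mP := dominated_measurable (@measurableT _ R) (prim_dominated a ig).
apply: (@eq_measurable_fun _ _ _ _ D (fun u => prim a (f \_ `[a, b]) (x - u))).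
  move=> u /set_mem /Db xub; apply: eq_Rintegral => t /set_mem.
  rewrite /= in_itv /= => /andP[at_ tx]; rewrite patchE mem_set//= in_itv /= at_.
  exact: le_trans tx xub.
apply: measurable_funTS; apply: measurableT_comp => //; exact: measurable_funB.
Qed.

End primitive.

(** * The identity for orders below 1 *)

Section order_lt1.
Context {R : realType}.
Local Notation mu := (@lebesgue_measure R).
Variables (a b n : R) (F phi : R -> R).
Hypotheses (ab : a < b) (n0 : 0 < n) (n1 : n < 1).
Hypotheses (CF : C0 a b F) (bvphi : bounded_variation a b phi).

Let D : set R := `]0, b - a]%classic.
Let w u := (Gamma n)^-1 * u `^ (n - 1).
Let Fc := F \o clip a b.
Let phic := extend_bv a b phi.
Let H p := \int[mu]_(u in D) (w u * Fc (p - u)).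

Let mD : measurable D. Proof. exact: measurable_itv. Qed.

Let ik : mu.-integrable D (EFin \o (fun u => u `^ (n - 1))).
Proof. by apply: integrable_powR; rewrite ?subr_gt0. Qed.

Let iw : mu.-integrable D (EFin \o w).
Proof. exact: (@integrableZl _ _ _ mu _ mD (Gamma n)^-1 _ ik). Qed.

Let scale_w (h : R -> R) K : measurable_fun D h -> (forall u, D u -> `|h u| <= K) ->
  (Gamma n)^-1 * \int[mu]_(u in D) (u `^ (n - 1) * h u) = \int[mu]_(u in D) (w u * h u).
Proof.
move=> mh hK; rewrite -RintegralZl//; last exact: integrable_mul_bounded ik mh hK.
by apply: eq_Rintegral => u _; rewrite mulrA.
Qed.

Let ucF : unif_cont Fc. Proof. exact: unif_cont_clip CF.1. Qed.

Let Fc0 p : p <= a -> Fc p = 0.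
Proof.
move=> pa; rewrite /Fc /= /clip max_l ?CF.2//; apply: le_trans pa.
by rewrite ge_min lexx.
Qed.

Let FcE p : a <= p <= b -> Fc p = F p.
Proof. by move=> h; rewrite /Fc /= clip_id. Qed.

Let mFc (A : set R) : measurable A -> measurable_fun A Fc.
Proof.
move=> mA; apply: measurable_funTS; apply: continuous_measurable_fun => p.
apply/cvgrPdist_le => e e0; have [d d0 h] := ucF e0.
apply/nbhs_ballP; exists d => // q pq; apply: h; exact: ltW.
Qed.

Let phicE p : a <= p <= b -> phic p = phi p.
Proof. by move=> h; rewrite /phic /extend_bv (andP h).2 clip_id. Qed.

Let mFr p : measurable_fun D (fun u => Fc (p - u)).
Proof.
apply: measurable_funTS; apply: measurableT_comp; first exact: mFc.
exact: measurable_funB.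
Qed.

(** Convolution with [w] is bounded in the sup norm by the L1 norm [W]. Applied to two translates of
    [Fc] this gives continuity of [H]; applied to [prim a (fk k)] against [Fc] it gives the
    convergence. *)
Lemma RLJ_frac_primP : RLJ_frac_prim a b n F H.
Proof.
have [K FK] := bounded_clip (ltW ab) CF.1.
pose W := \int[mu]_(u in D) `|w u|.
have W0 : 0 <= W by apply: Rintegral_ge0.
have Hdiff p q e : (forall u, D u -> `|Fc (p - u) - Fc (q - u)| <= e) ->
    `|H p - H q| <= e * W.
  move=> h; rewrite /H -RintegralB//.
  - under eq_Rintegral do rewrite -mulrBr.
    apply: norm_Rintegral_mul_le => //; have := mFr p; have := mFr q => mq mp.
    exact: measurable_funB.
  - by apply: (@integrable_mul_bounded _ _ _ mu _ mD _ _ K iw) => //; exact: mFr.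
  - by apply: (@integrable_mul_bounded _ _ _ mu _ mD _ _ K iw) => //; exact: mFr.
have ucH : unif_cont H.
  move=> e e0; have [d d0 osc] := ucF (divr_gt0 e0 (ltr_wpDl W0 ltr01)).
  exists d => // p q pq; apply: le_trans (Hdiff _ _ _ _) (ltW (ltr_divD1M e0 W0)).
  by move=> u _; apply: osc; rewrite opprB addrA subrK.
split.
  split.
    apply: continuous_subspaceT => p; apply/cvgrPdist_le => e e0.
    have [d d0 h] := ucH _ e0.
    by apply/nbhs_ballP; exists d => // q pq; apply: h; exact: ltW.
  rewrite /H; under eq_Rintegral => u /set_mem.
    rewrite /D /= in_itv /= => /andP[u0 _].
    rewrite Fc0 ?mulr0; last by rewrite gerBl ltW.
    over.
  by rewrite Rintegral_cst// mul0r.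
move=> fk ifk cvF e e0.
have e'0 := divr_gt0 e0 (ltr_wpDl W0 ltr01).
apply: filterS (cvF _ e'0) => k hk x xab.
have hu u : D u -> `|prim a (fk k) (x - u) - Fc (x - u)| <= e / (W + 1).
  rewrite /D /= in_itv /= => /andP[u0 _].
  (* Left of [a] the primitive integrates over an empty interval, and [Fc] is 0 since [F a = 0]. *)
  have [ax|xa] := leP a (x - u); last first.
    rewrite Fc0 1?ltW// /prim set_itv_ge ?Rintegral_set0 ?subrr ?normr0 ?(ltW e'0)//.
    by rewrite /= bnd_simp -ltNge.
  have xub : a <= x - u <= b by rewrite ax /=; case/andP: xab => _; lra.
  by rewrite FcE// ltW// hk.
have mP : measurable_fun D (fun u => prim a (fk k) (x - u)).
  apply: (measurable_prim_reflect _ (ifk k)) => // u; rewrite /D /= in_itv /= => /andP[? _].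
  by case/andP: xab => _; lra.
have PK u : D u -> `|prim a (fk k) (x - u)| <= e / (W + 1) + K.
  move=> /hu h; rewrite -[X in `|X|](subrK (Fc (x - u))).
  by apply: le_trans (ler_normD _ _) _; rewrite lerD// FK.
rewrite (prim_RLJ_L1 ab n0 n1 (ifk k) xab) (scale_w mP PK) /H -RintegralB//.
- under eq_Rintegral do rewrite -mulrBr.
  apply: le_lt_trans (ltr_divD1M e0 W0); apply: norm_Rintegral_mul_le => //.
  by have := mFr x; exact: measurable_funB.
- exact: (@integrable_mul_bounded _ _ _ mu _ mD _ _ (e / (W + 1) + K) iw).
- by apply: (@integrable_mul_bounded _ _ _ mu _ mD _ _ K iw) => //; exact: mFr.
Qed.

Lemma order_lt1_identity :
  exists v, LHS_val a b n F phi v /\ is_HKprod F (RLJ_right b n phi) a b v.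
Proof.
have [K FK] := bounded_clip (ltW ab) CF.1.
have [V [C [phiV VC phiC]]] := extend_bv_dominated (ltW ab) bvphi.
have mphi := dominated_measurable (@measurableT _ R) phiV.
have mphiu p : measurable_fun D (fun u => phic (p + u)).
  by apply: measurable_funTS; apply: measurableT_comp => //; exact: measurable_funD.
have GE p : a <= p <= b ->
    RLJ_right b n phi p = \int[mu]_(u in D) (w u * phic (p + u)).
  by move=> pab; rewrite (RLJ_right_frac ab n0 n1 phiV pab) (scale_w (mphiu p) (fun u _ => phiC _)).
have iwphi p : mu.-integrable D (EFin \o (fun u => w u * phic (p + u))).
  by apply: (@integrable_mul_bounded _ _ _ mu _ mD _ _ C iw) => //; exact: mphiu.
have iwF p : mu.-integrable D (EFin \o (fun u => w u * Fc (p - u))).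
  by apply: (@integrable_mul_bounded _ _ _ mu _ mD _ _ K iw) => //; exact: mFr.
pose I1 u := rs_int Fc (fun p => phic (p + u)) a b.
pose I2 u := rs_int (fun p => Fc (p - u)) phic a b.
have shiftV u : dominated (fun p => phic (p + u)) (fun p => V (p + u)).
  by move=> p q pq; apply: phiV; rewrite lerD2r.
have equi2 e : 0 < e -> exists2 d, 0 < d &
    forall u p q, `|p - q| <= d -> `|Fc (p - u) - Fc (q - u)| <= e.
  move=> /ucF[d d0 h]; exists d => // u p q pq; apply: h.
  by rewrite opprB addrA subrK.
have RS1 : is_RS F (RLJ_right b n phi) a b (\int[mu]_(u in D) (w u * I1 u)).
  apply: (is_RS_param (Fu := fun _ => Fc) (gu := fun u p => phic (p + u))
    (Vu := fun u p => V (p + u)) (C := C) (K := K)) => //.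
  - exact: ltW.
  - by move=> e /ucF[d d0 h]; exists d => // _ p q; exact: h.
  move=> t p q tab pab qab; rewrite !GE// -RintegralB// -RintegralZl//.
    by apply: eq_Rintegral => u _; rewrite FcE//; ring.
  have mqp := measurable_funB (mphiu q) (mphiu p).
  have -> : (fun u => w u * phic (q + u) - w u * phic (p + u)) =
      (fun u => w u * (phic (q + u) - phic (p + u))).
    by apply/funext => u; rewrite mulrBr.
  apply: (@integrable_mul_bounded _ _ _ mu _ mD _ _ (C + C) iw) => // u _.
  by apply: le_trans (ler_normB _ _) _; rewrite lerD.
have RS2 : is_RS H phi a b (\int[mu]_(u in D) (w u * I2 u)).
  apply: (is_RS_param (Fu := fun u p => Fc (p - u)) (gu := fun _ => phic)
    (Vu := fun _ => V) (C := C) (K := K)) => //.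
  - exact: ltW.
  move=> t p q tab pab qab; rewrite /H mulrC -RintegralZl//.
  by apply: eq_Rintegral => u _; rewrite !phicE//; ring.
have iwI2 : mu.-integrable D (EFin \o (fun u => w u * I2 u)).
  apply: (integrable_rs_int (Fu := fun u p => Fc (p - u)) (gu := fun _ => phic)
    (Vu := fun _ => V) (C := C) (K := K)) => //.
  exact: ltW.
(* Split [I1] at [b - u], where the translate of [phic] jumps from [phi b] to 0, and [I2] at
   [a + u], up to which the translate of [Fc] is 0. The other two pieces are translates of each
   other. *)
have I12 u : D u -> I1 u = I2 u - Fc (b - u) * phi b.
  rewrite /D /= in_itv /= => /andP[u0 uba].
  have ucFu : unif_cont (fun p => Fc (p - u)).
    by move=> e /equi2[d d0 h]; exists d => // p q; exact: h.
  rewrite /I1 (@rs_int_cat _ _ _ _ a (b - u) b _ _ ucF (shiftV u)); [|lra|lra].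
  rewrite /I2 (@rs_int_cat _ _ _ _ a (a + u) b _ _ ucFu phiV); [|lra|lra].
  rewrite (@rs_int_jump _ _ _ (b - u) b 0); last 2 first.
  - lra.
  - move=> p /andP[? _]; rewrite /phic /extend_bv ifF//; apply/negbTE; rewrite -ltNge; lra.
  rewrite subrK phicE ?lexx ?ltW//.
  have -> : rs_int (fun p => Fc (p - u)) phic (a + u) b =
      rs_int Fc (fun p => phic (p + u)) a (b - u).
    by rewrite -rs_int_shift subrK.
  rewrite (@rs_int_eq _ (fun p => Fc (p - u)) (fun=> 0) phic phic a (a + u)); last 3 first.
  - lra.
  - by move=> p /andP[_ ?]; rewrite Fc0//; lra.
  - by [].
  by rewrite rs_int0; ring.
(* No boundary term on the right: [RLJ_right b n phi b] integrates over one point. *)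
exists (- \int[mu]_(u in D) (w u * I1 u)); split; last first.
  exists (\int[mu]_(u in D) (w u * I1 u)) => //.
  by rewrite /RLJ_right set_itv1 Rintegral_set1 !mulr0 sub0r.
rewrite /LHS_val leNgt n1 /=; exists H; first exact: RLJ_frac_primP.
exists (\int[mu]_(u in D) (w u * I2 u)) => //.
(* Integrated against [w], the correction in [I12] is the boundary term [H b * phi b]. *)
rewrite /H mulrC -RintegralZl// -[RHS]opprB; congr (- _).
rewrite -RintegralB//; last exact: (@integrableZl _ _ _ mu _ mD (phi b) _ (iwF b)).
by apply: eq_Rintegral => u /set_mem Du; rewrite I12//; ring.
Qed.

End order_lt1.

(** * The identity for orders at least 1 *)

Section order_ge1.
Context {R : realType}.
Local Notation mu := (@lebesgue_measure R).
Variables (a b n : R) (F phi : R -> R).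
Hypotheses (ab : a < b) (n1 : 1 <= n).
Hypotheses (CF : C0 a b F) (bvphi : bounded_variation a b phi).

(** The null point [b] is left out: for [s = b] the cut-off of the kernel does not occur inside
    [[a, b]], and its jump would be missed. *)
Let D : set R := `[a, b[%classic.
Let Fc := F \o clip a b.
Let phic := extend_bv a b phi.
Let w s := (Gamma n)^-1 * phic s.
Let kpos (u : R) : R := Num.max 0 u `^ (n - 1).
(** The height of the jump at 0 is the power of 0: it is 1 for [n = 1] and 0 for [n > 1]. *)
Let kern (u : R) : R := if 0 <= u then u `^ (n - 1) else 0.

Let kpos_homo : {homo kpos : u v / u <= v}.
Proof.
move=> u v uv; rewrite /kpos; apply: ge0_ler_powR; rewrite ?subr_ge0//.
- by rewrite nnegrE le_max lexx.
- by rewrite nnegrE le_max lexx.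
- by rewrite ge_max !le_max lexx uv orbT.
Qed.

Let kern_ge0 u : 0 <= kern u.
Proof. by rewrite /kern; case: ifP => // _; exact: powR_ge0. Qed.

Let kern_homo : {homo kern : u v / u <= v}.
Proof.
move=> u v uv; rewrite {1}/kern; case: ifPn => // u0.
rewrite /kern (le_trans u0 uv); apply: ge0_ler_powR; rewrite ?subr_ge0// ?nnegrE//.
exact: le_trans u0 uv.
Qed.

Let reflect_dominated (k : R -> R) s : {homo k : u v / u <= v} ->
  dominated (fun p => k (s - p)) (fun p => - k (s - p)).
Proof.
move=> hk p q pq; have : k (s - q) <= k (s - p) by apply: hk; rewrite lerD2l lerN2.
by move=> h; rewrite ler0_norm ?subr_le0//; lra.
Qed.

Let mD : measurable D. Proof. exact: measurable_itv. Qed.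

Let ucF : unif_cont Fc. Proof. exact: unif_cont_clip CF.1. Qed.

Let FcE p : a <= p <= b -> Fc p = F p.
Proof. by move=> h; rewrite /Fc /= clip_id. Qed.

Let phicE p : a <= p <= b -> phic p = phi p.
Proof. by move=> h; rewrite /phic /extend_bv (andP h).2 clip_id. Qed.

Let mkern (A : set R) p : measurable A -> measurable_fun A (fun s => kern (s - p)).
Proof.
move=> mA; apply: nondecreasing_measurable => // s t st.
by apply: kern_homo; rewrite lerD2r.
Qed.

Let J s := rs_int Fc (fun p => kpos (s - p)) a s.
Let h s := (F s * 0 `^ (n - 1) - J s) / Gamma n.

Let RLJ_ge1_h s : a <= s <= b -> RLJ_ge1 a n F s (h s).
Proof.
move=> /andP[as_ sb]; exists (F s * 0 `^ (n - 1) - J s) => //; exists (J s).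
  apply: (is_RS_rs_int as_ ucF (reflect_dominated _ kpos_homo)) => p /andP[ap ps].
    by rewrite FcE// ap (le_trans ps).
  by rewrite /kpos max_r// subr_ge0.
by rewrite subrr.
Qed.

(** Up to [s] this is the Stieltjes integral in [h s]; beyond [s] only the jump of [kern]
    contributes. The result is minus the numerator of [h s]. *)
Let rs_int_kern s : D s -> rs_int Fc (fun p => kern (s - p)) a b = J s - F s * 0 `^ (n - 1).
Proof.
rewrite /D /= in_itv /= => /andP[as_ sb].
rewrite (rs_int_cat as_ (ltW sb) ucF (reflect_dominated s kern_homo)).
rewrite (@rs_int_jump _ _ _ s b 0)//; last first.
  by move=> p /andP[sp _]; rewrite /kern ifF//; apply/negbTE; rewrite -ltNge subr_lt0.
rewrite (@rs_int_eq _ Fc Fc _ (fun p => kpos (s - p)) a s)//; last first.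
  by move=> p /andP[_ ps]; rewrite /kern /kpos subr_ge0 ps max_r// subr_ge0.
by rewrite subrr /kern lexx FcE ?as_ ?ltW// sub0r mulrN.
Qed.

Lemma order_ge1_identity :
  exists v, LHS_val a b n F phi v /\ is_HKprod F (RLJ_right b n phi) a b v.
Proof.
have [K FK] := bounded_clip (ltW ab) CF.1.
have [V [C [phiV VC phiC]]] := extend_bv_dominated (ltW ab) bvphi.
have mphi := dominated_measurable (@measurableT _ R) phiV.
have muD : (mu D < +oo)%E.
  by rewrite /D lebesgue_measure_itv /=; case: ifP => // _; rewrite -EFinB ltry.
have mw : measurable_fun D w.
  by apply: measurable_funM; [exact: measurable_cst|exact: measurable_funTS].
have bounded_integrable (f : R -> R) M : measurable_fun D f ->
    (forall s, D s -> `|f s| <= M) -> mu.-integrable D (EFin \o f).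
  move=> mf fM; apply: measurable_bounded_integrable => //.
  exists M; split; first exact: num_real.
  by move=> x Mx y Dy; apply: le_trans (fM _ Dy) (ltW Mx).
have iphic : mu.-integrable D (EFin \o phic).
  by apply: (bounded_integrable _ C) => //; exact: measurable_funTS.
have iw : mu.-integrable D (EFin \o w).
  exact: (@integrableZl _ _ _ mu _ mD (Gamma n)^-1 _ iphic).
have kern_le s p : D s -> a <= p -> `|kern (s - p)| <= kern (b - a).
  rewrite /D /= in_itv /= => /andP[_ sb] ap; rewrite ger0_norm//; apply: kern_homo.
  by rewrite lerB// ltW.
have iwk (c : R -> R) p : a <= p -> mu.-integrable D (EFin \o c) ->
    mu.-integrable D (EFin \o (fun s => c s * kern (s - p))).
  move=> ap ic; have mk := mkern p mD.
  by apply: (@integrable_mul_bounded _ _ _ mu _ mD _ _ (kern (b - a)) ic) => // s /kern_le; exact.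
(* The cut-off in [kern] replaces the moving lower limit [p] by the fixed domain [D]. *)
have GE p : a <= p <= b ->
    RLJ_right b n phi p = \int[mu]_(s in D) (w s * kern (s - p)).
  move=> /andP[ap pb].
  have -> : \int[mu]_(s in D) (w s * kern (s - p)) =
      \int[mu]_(s in D) ((Gamma n)^-1 * (phic s * kern (s - p))).
    by apply: eq_Rintegral => s _; rewrite mulrA.
  rewrite RintegralZl//; last exact: iwk.
  rewrite /RLJ_right; congr (_ * _).
  have pD : `[p, b[ `<=` D.
    by move=> s; rewrite /D /= !in_itv /= => /andP[/(le_trans ap) -> ->].
  have E s : `[p, b[%classic s -> (s - p) `^ (n - 1) * phi s = phic s * kern (s - p).
    rewrite /= in_itv /= => /andP[ps sb].
    by rewrite phicE ?(le_trans ap ps) ?ltW// /kern subr_ge0 ps mulrC.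
  rewrite -Rintegral_itv_bndo_bndc; last first.
    apply: (@eq_integrable _ _ _ mu _ _ (EFin \o (fun s => phic s * kern (s - p)))) => //.
      by move=> s /set_mem sp; rewrite /= E.
    apply: integrableS (iwk _ _ ap iphic) => //.
  rewrite Rintegral_mkcond [RHS]Rintegral_mkcond; apply: eq_Rintegral => s _.
  rewrite !patchE; case: ifPn => [/set_mem sp|/negP sp].
    by rewrite mem_set ?E//; exact: pD.
  case: ifPn => // /set_mem; rewrite /D /= in_itv /= => /andP[as_ sb].
  rewrite /kern ifF ?mulr0//; apply/negbTE; rewrite subr_ge0; apply/negP => ps.
  by apply: sp; rewrite inE /= in_itv /= ps.
have VuC s : D s -> - kern (s - b) - - kern (s - a) <= kern (b - a).
  move=> Ds; have := kern_le s a Ds (lexx _); have := kern_ge0 (s - b).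
  rewrite ger0_norm//; lra.
have equiF e : 0 < e -> exists2 d, 0 < d &
    forall u p q : R, `|p - q| <= d -> `|Fc p - Fc q| <= e.
  by move=> /ucF[d d0 hd]; exists d => // _ p q; exact: hd.
pose I s := rs_int Fc (fun p => kern (s - p)) a b.
have RS1 : is_RS F (RLJ_right b n phi) a b (\int[mu]_(s in D) (w s * I s)).
  apply: (is_RS_param (Fu := fun _ => Fc) (gu := fun s p => kern (s - p))
    (Vu := fun s p => - kern (s - p)) (C := kern (b - a)) (K := K)) => //.
  - exact: ltW.
  - by move=> s; exact: reflect_dominated.
  - by move=> p; exact: mkern.
  move=> t p q tab pab qab; rewrite !GE// -RintegralB//; last 2 first.
  - by apply: iwk => //; case/andP: qab.
  - by apply: iwk => //; case/andP: pab.
  rewrite -RintegralZl//.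
    by apply: eq_Rintegral => u _; rewrite FcE//; ring.
  have ip : mu.-integrable D (EFin \o (fun s => w s * kern (s - p))).
    by apply: iwk => //; case/andP: pab.
  have iq : mu.-integrable D (EFin \o (fun s => w s * kern (s - q))).
    by apply: iwk => //; case/andP: qab.
  exact: (@integrableB _ _ _ mu _ mD _ _ iq ip).
have iwI : mu.-integrable D (EFin \o (fun s => w s * I s)).
  apply: (integrable_rs_int (Fu := fun _ => Fc) (gu := fun s p => kern (s - p))
    (Vu := fun s p => - kern (s - p)) (C := kern (b - a)) (K := K)) => //.
  - exact: ltW.
  - by move=> s; exact: reflect_dominated.
  - by move=> p; exact: mkern.
have phih s : D s -> phi s * h s = - (w s * I s).
  move=> Ds; rewrite /I rs_int_kern// /h /w phicE; first by ring.
  by move: Ds; rewrite /D /= in_itv /= => /andP[-> /ltW].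
have iphih : mu.-integrable D (EFin \o (fun s => phi s * h s)).
  apply: (@eq_integrable _ _ _ mu _ mD (EFin \o (fun s => (-1) * (w s * I s)))).
    by move=> s /set_mem Ds; rewrite /= phih// mulN1r.
  exact: (@integrableZl _ _ _ mu _ mD (-1) _ iwI).
exists (- \int[mu]_(s in D) (w s * I s)); split; last first.
  exists (\int[mu]_(s in D) (w s * I s)) => //.
  by rewrite /RLJ_right set_itv1 Rintegral_set1 !mulr0 sub0r.
rewrite /LHS_val n1; exists h; split.
- exact: RLJ_ge1_h.
- have /integrableP[mphih foo] := iphih.
  apply/integrableP; split.
    apply/measurable_EFinP; apply: (measurable_fun_itv_bndo_bndcP _ _ _).1.
    exact/measurable_EFinP.
  rewrite -integral_itv_bndo_bndc//.
  by apply: measurableT_comp => //.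
rewrite -Rintegral_itv_bndo_bndc//.
rewrite -mulN1r -RintegralZl//; apply: eq_Rintegral => s /set_mem Ds.
by rewrite mulN1r phih.
Qed.

End order_ge1.

Theorem theorem4p8 (R : realType) (a b n : R) (F phi : R -> R) :
  a < b -> 0 < n -> C0 a b F -> bounded_variation a b phi ->
  exists v : R, LHS_val a b n F phi v /\ is_HKprod F (RLJ_right b n phi) a b v.
Proof.
move=> ab n0 CF bv; have [n1|n1] := leP 1 n; first exact: order_ge1_identity.
exact: order_lt1_identity.
Qed.
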